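(* Let $\{\mu_i\}_{i=1}^n$ be a flat family of measures with deviation in $\mathbb R^n$, and let numbers $\alpha_1,\dots,\alpha_n$ satisfy, for each $i$, either $\alpha_i=\varepsilon(\mu_i)$ or $\alpha_i=1-\varepsilon(\mu_i)$. Then there exists a half-space $H\subset\mathbb R^n$ such that $\mu_i(H)=\alpha_i$ for all $i=1,\dots,n$.
   Context: A probability measure $\mu$ on $\mathbb R^n$ is called continuous if $\mu(H)$ depends continuously on the half-space $H$. A measure with deviation is a pair of a continuous probability measure $\mu$ with compact support and a number $\varepsilon(\mu)\in[0,1/2)$. A hyperplane $h$ reliably intersects $\mu$ if both half-spaces $H_1,H_2$ bounded by $h$ satisfy $\mu(H_j)\ge\varepsilon(\mu)$. The space of hyperplanes of $\mathbb R^n$ is identified with the total space $\gamma_n^1$ of the canonical line bundle over $G_n^1=\mathbb RP^{n-1}$, a hyperplane $h$ corresponding to the pair $(l,\,h\cap l)$ where $l$ is the line through the origin orthogonal to $h$. For a family $\{\mu_i\}_{i=1}^n$ of measures with deviation, let $X\subseteq\gamma_n^1$ be the set of hyperplanes reliably intersecting all $\mu_i$, and $p:X\to G_n^1$ the restriction of the bundle projection. The family is called flat if there is a continuous map $\tilde p:X\to S^{n-1}$ with $p=\pi\circ\tilde p$, where $\pi:S^{n-1}\to G_n^1$ is the double covering $u\mapsto\mathbb Ru$. *)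

(* Defs.v *)
From HB Require Import structures.
From mathcomp Require Import all_boot all_order all_algebra.
From mathcomp Require Import all_classical all_reals all_analysis.

Set Implicit Arguments.
Unset Strict Implicit.
Unset Printing Implicit Defensive.

Import Order.TTheory GRing.Theory Num.Theory.
Import numFieldNormedType.Exports.

Local Open Scope classical_set_scope.
Local Open Scope ring_scope.
Local Open Scope quotient_scope.

Section EuclideanSpace.
Context {R : realType} {n : nat}.
Local Notation V := 'rV[R]_n.

Definition dot (x y : V) : R := \sum_(i < n) x ord0 i * y ord0 i.

(* The norm of 'rV[R]_n in the library is the sup norm; unit vectors are taken
   here for the Euclidean one. *)
Definition sphere : set V := [set u | dot u u = 1].

(* Each half-space of R^n is halfspace u t for exactly one pair (u, t), so the
   space of half-spaces is S^{n-1} x R. *)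
Definition halfspace (u : sphere) (t : R) : set V :=
  [set x | t <= dot (val u) x].

Definition hyperplane (u : sphere) (t : R) : set V :=
  [set x | dot (val u) x = t].

Definition is_halfspace (H : set V) : Prop := exists u t, H = halfspace u t.

Definition antipodal (u v : sphere) : bool :=
  (val u == val v) || (val u == - val v).

Lemma antipodal_refl : reflexive antipodal.
Proof. by move=> u; rewrite /antipodal eqxx. Qed.

Lemma antipodal_sym : symmetric antipodal.
Proof.
by move=> u v; rewrite /antipodal eq_sym [val u == - _]eq_sym eqr_oppLR.
Qed.

Lemma antipodal_trans : transitive antipodal.
Proof.
move=> v u w; rewrite /antipodal.
by do 2![case/orP=> /eqP->]; rewrite ?opprK eqxx ?orbT.
Qed.

Canonical antipodal_equiv :=
  EquivRel antipodal antipodal_refl antipodal_sym antipodal_trans.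

(* RP^{n-1} with the quotient topology; a point of it is a line through 0. *)
Definition projective_space : Type :=
  quotient_topology {eq_quot antipodal_equiv}.
HB.instance Definition _ := Topological.on projective_space.
HB.instance Definition _ := Quotient.on projective_space.

Definition double_cover (u : sphere) : projective_space :=
  \pi_projective_space u.

Definition line (l : projective_space) : set V :=
  [set x | exists (u : sphere) (a : R), double_cover u = l /\ x = a *: val u].

(* Total space of the canonical line bundle over RP^{n-1}, topologized as a
   subspace of RP^{n-1} x R^n. *)
Definition canonical_bundle : set (projective_space * V) :=
  [set z | line z.1 z.2].

(* The hyperplane h encoded by (l, h `&` l). *)
Definition bundle_hyperplane (z : canonical_bundle) : set V :=
  [set y | forall v, line (val z).1 v -> dot v (y - (val z).2) = 0].

End EuclideanSpace.

Arguments sphere R n : clear implicits.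
Arguments projective_space R n : clear implicits.
Arguments canonical_bundle R n : clear implicits.

Section Measures.
Context {R : realType} {n : nat}.
Local Notation V := 'rV[R]_n.

Definition support (mu : set V -> \bar R) : set V :=
  [set x | forall U, open U -> U x -> (0 < mu U)%E].

Definition continuous_measure (mu : set V -> \bar R) : Prop :=
  continuous (fun H : sphere R n * R => mu (halfspace H.1 H.2)).

End Measures.

Record deviation_measure (R : realType) (n : nat) := DeviationMeasure {
  dev_measure :> probability (g_sigma_algebraType (@open 'rV[R]_n)) R;
  deviation : R;
  dev_measure_continuous : continuous_measure dev_measure;
  dev_measure_compact : compact (support dev_measure);
  deviation_bounds : 0 <= deviation < 2^-1 }.

Section Families.
Context {R : realType} {n : nat}.
Local Notation V := 'rV[R]_n.

(* A hyperplane equals hyperplane u t for two opposite values of (u, t), which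
   give the two half-spaces it bounds. *)
Definition reliably_intersects (h : set V) (mu : deviation_measure R n) : Prop :=
  forall u t, h = hyperplane u t -> ((deviation mu)%:E <= mu (halfspace u t))%E.

Definition reliable_hyperplanes (mu : 'I_n -> deviation_measure R n) :
    set (canonical_bundle R n) :=
  [set z | forall i, reliably_intersects (bundle_hyperplane z) (mu i)].

Definition flat (mu : 'I_n -> deviation_measure R n) : Prop :=
  exists p' : reliable_hyperplanes mu -> sphere R n,
    continuous p' /\ forall z, (val (val z)).1 = double_cover (p' z).

End Families.

(* Main.v *)
Require Import Defs.
From mathcomp Require Import all_boot all_order all_algebra.
From mathcomp Require Import all_classical all_reals all_analysis.
From mathcomp Require Import ring lra.

Set Implicit Arguments.
Unset Strict Implicit.
Unset Printing Implicit Defensive.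

Import Order.TTheory GRing.Theory Num.Theory.
Import numFieldNormedType.Exports.
Local Open Scope classical_set_scope.
Local Open Scope ring_scope.

(** Write a half-space as [{x | t <= v.x}] with [(v, t)] a nonzero vector of
    [R^(1+n)].  After centering at [1/2] and dividing the [i]-th coordinate by
    [alpha_i - 1/2], the measures of a half-space form an odd map [phi] from
    [R^(1+n) - 0] to [R^n]; the hyperplanes reliably intersecting all measures
    are those with [|phi| <= 1] in the sup norm, and [phi = (1, ..., 1)] has to
    be solved.  Flatness gives an odd continuous sign [sg] on [|phi| <= 1].
    The map [phi - k sg max(0, 1 - |phi|) (1, ..., 1)] is then odd and
    continuous, so by the Borsuk-Ulam theorem it has a zero, at which
    [phi = +- k/(1+k) (1, ..., 1)]; now let [k] tend to infinity.

    Borsuk-Ulam is proved with cochains mod 2 on finite sequences of points: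
    for odd [s_1, ..., s_n] with values in [F_2], the cup product of their
    coboundaries takes the value [1] on the [n]-dimensional hemisphere of any
    iterated barycentric subdivision of the cross-polytope, while for the signs
    of the coordinates of a nowhere zero map it vanishes on small simplices. *)

(** * Cochains modulo 2 and barycentric subdivision *)

Section Cochains.
Variable T : eqType.
Implicit Types (c : seq T -> bool) (s t : seq T).

(** A sum over all deletions of one vertex, split according to whether the head is deleted or kept;
    the split turns the identities below into inductions on the list. *)
Fixpoint cobound c s : bool :=
  if s is x :: s' then c s' (+) cobound (fun t => c (x :: t)) s' else false.

Lemma eq_cobound c c' s :
  (forall t, (size t).+1 = size s -> {subset t <= s} -> c t = c' t) ->
  cobound c s = cobound c' s.
Proof.
elim: s c c' => [//|x s IHs] c c' eq_c /=; congr (_ (+) _).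
  by apply: eq_c => // y ys; rewrite inE ys orbT.
apply: IHs => t tE ts; apply: eq_c => /=; first by rewrite tE.
by move=> y; rewrite !inE => /orP[->//|/ts->]; rewrite orbT.
Qed.

Lemma cobound_addb c c' s :
  cobound (fun t => c t (+) c' t) s = cobound c s (+) cobound c' s.
Proof.
by elim: s c c' => [//|x s IHs] c c' /=; rewrite IHs addbACA.
Qed.

Lemma cobound_andb b c s : cobound (fun t => b && c t) s = b && cobound c s.
Proof.
by elim: s c => [|x s IHs] c /=; rewrite ?andbF// IHs; case: (b).
Qed.

(** The faces missing the head and one later vertex arise twice and cancel; what remains is the
    double coboundary of [c (x :: _)] on a shorter list. *)
Lemma cobound_cobound c s : cobound (cobound c) s = false.
Proof.
elim: s c => [//|x s IHs] c /=.
by rewrite (cobound_addb c) IHs addbF addbb.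
Qed.

Lemma cobound_map (f : T -> T) c s :
  cobound (fun t => c (map f t)) s = cobound c (map f s).
Proof. by elim: s c => [//|x s IHs] c /=; rewrite (IHs (fun t => c (f x :: t))). Qed.

Definition cup0 (f : T -> bool) c s : bool :=
  if s is x :: _ then f x && c s else false.

(* The cup product of the coboundaries of the 0-cochains [f i], for [i < d]. *)
Fixpoint cup_cobound (f : nat -> T -> bool) d s : bool :=
  match d, s with
  | d'.+1, x :: ((y :: _) as s') => (f d' x (+) f d' y) && cup_cobound f d' s'
  | _, _ => true
  end.

(** Leibniz rule for a cocycle. As [cobound c s = false], the faces that keep the head [x] sum to
    the value of [c] on the face without it, so their common factor [g x] joins the [g y] of that
    face. *)
Lemma cobound_cup0 g c s : (1 < size s)%N -> cobound c s = false ->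
  cobound (cup0 g c) s =
    if s is x :: ((y :: _) as s') then (g x (+) g y) && c s' else false.
Proof.
case: s => [//|x [//|y s]] _ dc0.
have dcE : cobound (fun t => c (x :: t)) (y :: s) = c (y :: s).
  by move: dc0 => /=; case: (c _); case: (c _ (+) _).
rewrite -[LHS]/((g y && c (y :: s)) (+) cobound (fun t => g x && c (x :: t)) (y :: s)).
by rewrite cobound_andb dcE addbC -andb_addl.
Qed.

(** By induction the product of degree [d + 1] is itself a coboundary, that of
    [cup0 (f d) (cup_cobound f d)], and double coboundaries vanish. *)
Lemma cobound_cup_cobound f d s :
  size s = d.+2 -> cobound (cup_cobound f d) s = false.
Proof.
elim: d s => [|d IHd] s; first by case: s => [//|x [//|y []]].
move=> sE; rewrite -[RHS](cobound_cobound (cup0 (f d) (cup_cobound f d)) s).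
apply: eq_cobound => t + _; rewrite sE => -[tE].
by rewrite cobound_cup0 ?IHd ?tE//; case: t tE => [//|x []].
Qed.

Lemma cup_coboundS f d s : size s = d.+2 ->
  cup_cobound f d.+1 s = cobound (cup0 (f d) (cup_cobound f d)) s.
Proof.
move=> sE; rewrite cobound_cup0 ?cobound_cup_cobound ?sE//.
by case: s sE => [//|x []].
Qed.

(** Both ends of every edge change value, so each factor [f i x (+) f i y] is unchanged. *)
Lemma cup_cobound_odd (a : T -> T) f d s :
  (forall i, (i < d)%N -> {in s, forall x, f i (a x) = ~~ f i x}) ->
  cup_cobound f d (map a s) = cup_cobound f d s.
Proof.
elim: d s => [//|d IHd] [//|x [//|y s]] f_odd /=.
rewrite !f_odd ?inE ?eqxx ?orbT// addNb addbN negbK; congr (_ && _).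
apply: (IHd (y :: s)) => i id z zs; apply: (f_odd i (ltnW id)).
by apply/orP; right; exact: zs.
Qed.

(** The factor of index [i] is a difference of two values of [f i] on [s], hence zero. *)
Lemma cup_cobound_const f d i s : (i < d)%N -> size s = d.+1 ->
  {in s &, forall x y, f i x = f i y} -> cup_cobound f d s = false.
Proof.
elim: d s => [//|d IHd] [//|x [//|y s]]; rewrite ltnS leq_eqVlt => id [sE] f_cst.
rewrite [LHS]/=; case/orP: id => [/eqP <-|id].
  by rewrite (f_cst x y) ?addbb// !inE eqxx ?orbT.
rewrite (IHd (y :: s)) ?andbF//= ?sE//.
by move=> z t zs ts; apply: f_cst; rewrite in_cons ?zs ?ts orbT.
Qed.

End Cochains.

(** * Barycentric subdivision as an operation on cochains *)

Section Subdivision.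
Variables (R : realFieldType) (V : lmodType R).
Implicit Types (c : seq V -> bool) (s t : seq V).

Definition barycenter s : V := (size s)%:R^-1 *: \sum_(x <- s) x.

(* The pullback of [c] along barycentric subdivision, on simplices with [k]
   vertices: subdividing [s] joins its barycenter to its subdivided facets. *)
Fixpoint subdiv_rec k c s : bool :=
  if k is k'.+1 then cobound (subdiv_rec k' (fun t => c (barycenter s :: t))) s
  else c [::].

Definition subdiv c s := subdiv_rec (size s) c s.

(** A descending flag of faces of [s], recorded by barycenters, largest face first. Faces are
    constrained by size and vertex set only, which covers every list at which [subdiv c s] evaluates
    [c]. *)
Inductive piece : seq V -> seq V -> Prop :=
| Piece0 : piece [::] [::]
| PieceS s r t : (size r).+1 = size s -> {subset r <= s} -> piece t r ->
    piece (barycenter s :: t) s.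

Lemma eq_subdiv c c' s :
  (forall t, piece t s -> c t = c' t) -> subdiv c s = subdiv c' s.
Proof.
rewrite /subdiv; move kE : (size s) => k.
elim: k c c' s kE => [|k IHk] c c' s sE eq_c /=.
  by rewrite (size0nil sE) in eq_c *; apply: eq_c; exact: Piece0.
apply: eq_cobound => r; rewrite sE => -[rE] rs; apply: IHk => // t tr.
by apply: eq_c; apply: PieceS tr; rewrite ?rE.
Qed.

Lemma subdiv_addb c c' s :
  subdiv (fun t => c t (+) c' t) s = subdiv c s (+) subdiv c' s.
Proof.
rewrite /subdiv; move: (size s) => k; elim: k c c' s => [//|k IHk] c c' s /=.
by rewrite -cobound_addb; apply: eq_cobound => t _ _; rewrite IHk.
Qed.

Lemma barycenterN s : barycenter (map -%R s) = - barycenter s.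
Proof. by rewrite /barycenter size_map big_map sumrN scalerN. Qed.

Lemma barycenter1 x : barycenter [:: x] = x.
Proof. by rewrite /barycenter big_seq1 invr1 scale1r. Qed.

Lemma subdivN c s : subdiv (fun t => c (map -%R t)) s = subdiv c (map -%R s).
Proof.
rewrite /subdiv size_map; move: (size s) => k; elim: k c s => [//|k IHk] c s /=.
rewrite -cobound_map barycenterN; apply: eq_cobound => t _ _.
by rewrite -IHk.
Qed.

(** Subdivision is a chain map. With [b] the barycenter, [cobound c (b :: t)] is [c t] plus the
    coboundary of [c (b :: _)] at [t]; by induction the latter contributes a double coboundary,
    which vanishes. *)
Lemma subdiv_rec_cobound c k s : size s = k.+1 ->
  subdiv_rec k.+1 (cobound c) s = cobound (subdiv_rec k c) s.
Proof.
elim: k c s => [|k IHk] c s sE; set b := barycenter s.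
  rewrite /=; apply: eq_cobound => t; rewrite sE => -[/size0nil-> _] /=.
  exact: addbF.
rewrite -[LHS]/(cobound
  (subdiv_rec k.+1 (fun t => c t (+) cobound (fun t' => c (b :: t')) t)) s).
transitivity (cobound (fun t => subdiv_rec k.+1 c t (+)
    cobound (subdiv_rec k (fun t' => c (b :: t'))) t) s).
  apply: eq_cobound => t; rewrite sE => -[tE _].
  by rewrite -IHk// -tE -/(subdiv _ t) subdiv_addb.
by rewrite cobound_addb cobound_cobound addbF.
Qed.

Lemma subdiv_cobound c s : subdiv (cobound c) s = cobound (subdiv c) s.
Proof.
case sE : (size s) => [|k]; first by rewrite (size0nil sE).
rewrite /subdiv sE subdiv_rec_cobound//; apply: eq_cobound => t.
by rewrite sE => -[->].
Qed.

Lemma size_piece t s : piece t s -> size t = size s.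
Proof. by elim=> // {}s r {}t <- _ _ /= ->. Qed.

Definition bary_closed (Q : V -> Prop) :=
  forall s, s != [::] -> {in s, forall x, Q x} -> Q (barycenter s).

Lemma piece_bary_closed (Q : V -> Prop) t s : bary_closed Q ->
  piece t s -> {in s, forall x, Q x} -> {in t, forall x, Q x}.
Proof.
move=> Qb; elim=> // {}s r {}t rE rs _ IHt Qs x; rewrite inE => /orP[/eqP ->|].
  by apply: Qb => //; rewrite -size_eq0 -rE.
by apply: IHt => y /rs; exact: Qs.
Qed.

(* The mod 2 chains [h_0 = e_0] and [h_(d+1) = e_(d+1) * (h_d + a h_d)], where
   [a] is the antipodal map: hemispheres with [d h_(d+1) = h_d + a h_d]. *)
Fixpoint hemisphere (e : nat -> V) d c : bool :=
  if d is d'.+1 then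
    hemisphere e d' (fun t => c (e d :: t)) (+)
    hemisphere e d' (fun t => c (e d :: map -%R t))
  else c [:: e 0%N].

Lemma hemisphere_addb e d c c' :
  hemisphere e d (fun t => c t (+) c' t) = hemisphere e d c (+) hemisphere e d c'.
Proof. by elim: d c c' => [//|d IHd] c c' /=; rewrite !IHd addbACA. Qed.

Lemma eq_hemisphere e d c c' :
  (forall s, size s = d.+1 -> c s = c' s) -> hemisphere e d c = hemisphere e d c'.
Proof.
elim: d c c' => [|d IHd] c c' eq_c /=; first exact: eq_c.
by congr (_ (+) _); apply: IHd => s sE; apply: eq_c; rewrite /= ?size_map sE.
Qed.

(** The boundary of a cone is its base plus the cone over the boundary of the base. The bases give
    [h_d + a h_d], and the cones cancel because [h_d] and [a h_d] have the same boundary by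
    induction. *)
Lemma hemisphere_cobound e d c :
  hemisphere e d.+1 (cobound c) =
  hemisphere e d c (+) hemisphere e d (fun t => c (map -%R t)).
Proof.
elim: d c => [|d IHd] c; first by rewrite /= !addbF addbACA addbb addbF.
set ce := fun t => c (e d.+2 :: t).
transitivity (hemisphere e d.+1 (fun t => c t (+) cobound ce t) (+)
    hemisphere e d.+1 (fun t => c (map -%R t) (+) cobound ce (map -%R t))).
  by [].
rewrite (hemisphere_addb e d.+1 c) (hemisphere_addb e d.+1 (fun t => c (map _ t))).
rewrite addbACA -[RHS]addbF; congr (_ (+) _).
rewrite (@eq_hemisphere _ _ (fun t => _ ce (map _ t))
  (cobound (fun t => ce (map -%R t)))); last first.
  by move=> s _; rewrite cobound_map.
rewrite !IHd (@eq_hemisphere _ _ (fun t => ce (map _ (map _ t))) ce); last first.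
  move=> s _; congr ce.
  by rewrite -map_comp -[RHS]map_id; apply: eq_map => v /=; rewrite opprK.
by rewrite [X in _ (+) X]addbC addbb.
Qed.

End Subdivision.

(** * Decrease of the mesh under subdivision *)

Section Mesh.
Variables (R : realType) (V : normedModType R).
Implicit Types (c : seq V -> bool) (s t : seq V).

Definition mesh_le (D : R) s := {in s &, forall x y, `|x - y| <= D}.

Lemma sum_seq_const (M : nmodType) (T : Type) (a : M) (s : seq T) :
  \sum_(x <- s) a = a *+ size s.
Proof. by rewrite big_const_seq count_predT iter_addr_0. Qed.

Lemma barycenter_subl (a : V) s : s != [::] ->
  barycenter s - a = (size s)%:R^-1 *: \sum_(x <- s) (x - a).
Proof.
move=> s0; rewrite big_split/= scalerDr; congr (_ + _).
rewrite sum_seq_const -[- a *+ _]scaler_nat scalerA mulVf ?scale1r//.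
by rewrite pnatr_eq0 size_eq0.
Qed.

Lemma ball_bary_closed (a : V) (D : R) : bary_closed (fun x => `|x - a| <= D).
Proof.
move=> s s0 sD; rewrite barycenter_subl// normrZ normfV normr_nat.
rewrite mulrC ler_pdivrMr ?ltr0n ?lt0n ?size_eq0//.
apply: (le_trans (ler_norm_sum _ _ _)); rewrite mulr_natr.
rewrite -(sum_seq_const D s).
by rewrite big_seq [leRHS]big_seq; apply: ler_sum.
Qed.

(** In the average of the differences to [x] the term of [x] itself is zero, which saves one part in
    [size s], hence at least one in [N + 1]. *)
Lemma barycenter_dist (D : R) N s x : 0 <= D -> (size s <= N.+1)%N ->
  mesh_le D s -> x \in s -> `|barycenter s - x| <= (1 - N.+1%:R^-1) * D.
Proof.
move=> D0 sN sD xs; have s0 : s != [::] by apply: contraTneq xs => ->.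
have m0 : (0 < size s)%N by rewrite lt0n size_eq0.
rewrite barycenter_subl// normrZ normfV normr_nat.
apply: (@le_trans _ _ ((1 - (size s)%:R^-1) * D)); last first.
  by rewrite ler_wpM2r// lerB// lef_pV2 ?posrE ?ltr0n// ler_nat.
rewrite mulrC ler_pdivrMr ?ltr0n// mulrAC mulrBl mul1r mulVf ?pnatr_eq0 -?lt0n//.
rewrite (perm_big _ (perm_to_rem xs)) big_cons/= subrr add0r.
apply: (le_trans (ler_norm_sum _ _ _)).
apply: (@le_trans _ _ (\sum_(y <- rem x s) D)).
  by rewrite big_seq [leRHS]big_seq; apply: ler_sum => y /mem_rem ys; exact: sD.
rewrite sum_seq_const size_rem// -[leLHS]mulr_natl.
by rewrite -subn1 natrB.
Qed.

(** The later vertices of a piece come from a smaller face, so they stay in any ball about the first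
    barycenter that contains the vertices of that face; [barycenter_dist] gives the radius. The
    factor depends on [N] alone and can be iterated. *)
Lemma piece_mesh (D : R) N t s : 0 <= D -> (size s <= N.+1)%N ->
  piece t s -> mesh_le D s -> mesh_le ((1 - N.+1%:R^-1) * D) t.
Proof.
move=> D0 + ts; elim: ts => // {}s r {}t rE rs tr IHt sN sD.
have rD : mesh_le D r by move=> x y /rs xs /rs ys; exact: sD.
have {IHt rD} tD := IHt (leq_trans (leqnSn _) (leq_trans (eq_leq rE) sN)) rD.
have bt x : x \in t -> `|x - barycenter s| <= (1 - N.+1%:R^-1) * D.
  apply: (piece_bary_closed (@ball_bary_closed (barycenter s) _) tr) => y /rs ys.
  by rewrite distrC; exact: barycenter_dist.
have q0 : 0 <= (1 - N.+1%:R^-1) * D.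
  by rewrite mulr_ge0// subr_ge0 invf_le1 ?ler1n ?ltr0n.
move=> x y; rewrite !inE => /orP[/eqP->|xt] /orP[/eqP->|yt].
- by rewrite subrr normr0.
- by rewrite distrC bt.
- exact: bt.
- exact: tD.
Qed.

End Mesh.

(** * The Borsuk-Ulam theorem *)

Section Crosspolytope.
Variables (R : realType) (n : nat).
Local Notation V := 'rV[R]_n.+1.
Implicit Types (c : seq V -> bool) (s t : seq V) (x y : V).

Definition crosspolytope : set V := [set x | \sum_i `|x ord0 i| = 1].

(** For a sign vector [y], the facet of the cross-polytope in the closed orthant of [y]. The
    conditions are linear in [x] and hence, unlike [crosspolytope], pass to barycenters. *)
Definition face (y : V) (x : V) : Prop :=
  \sum_i y ord0 i * x ord0 i = 1 /\ forall i, 0 <= y ord0 i * x ord0 i.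

Definition sign_vector (y : V) : Prop := forall i, `|y ord0 i| = 1.

Lemma face_crosspolytope y x : sign_vector y -> face y x -> crosspolytope x.
Proof.
move=> y1 [yx1 yx]; rewrite /crosspolytope/= -yx1; apply: eq_bigr => i _.
by rewrite -[LHS]mul1r -(y1 i) -normrM ger0_norm.
Qed.

Lemma face_bary_closed y : bary_closed (face y).
Proof.
move=> s s0 sy; have bE i : y ord0 i * barycenter s ord0 i =
    (size s)%:R^-1 * \sum_(x <- s) y ord0 i * x ord0 i.
  by rewrite mxE summxE mulrCA mulr_sumr.
split=> [|i]; last first.
  rewrite bE mulr_ge0 ?invr_ge0// big_seq sumr_ge0// => x xs.
  by have [_] := sy x xs; exact.
under eq_bigr do rewrite bE.
rewrite -mulr_sumr exchange_big /= big_seq.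
under eq_bigr => x xs do rewrite (sy x xs).1.
rewrite -big_seq sum_seq_const mulVf//.
by rewrite pnatr_eq0 size_eq0.
Qed.

Lemma crosspolytope_neq0 x : crosspolytope x -> x != 0.
Proof.
move=> Kx; apply/eqP => x0; move: Kx; rewrite /crosspolytope/= x0 big1.
  by move/eqP; rewrite eq_sym oner_eq0.
by move=> i _; rewrite mxE normr0.
Qed.

Lemma crosspolytopeN x : crosspolytope x -> crosspolytope (- x).
Proof.
move=> Kx; rewrite /crosspolytope/= -[RHS]Kx.
by apply: eq_bigr => i _; rewrite mxE normrN.
Qed.

Lemma coord_norm_le m (x : 'rV[R]_m) i : `|x ord0 i| <= `|x|.
Proof.
rewrite {2}/Num.norm/= mx_normrE.
by apply: le_trans (le_bigmax _ _ (ord0, i)).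
Qed.

Lemma norm_le_coord m (x : 'rV[R]_m) (a : R) : 0 <= a ->
  (forall i, `|x ord0 i| <= a) -> `|x| <= a.
Proof.
move=> a0 xa; rewrite {1}/Num.norm/= mx_normrE.
by apply: bigmax_le => // -[j i] _; rewrite (ord1 j); exact: xa.
Qed.

Lemma norm_attained m (x : 'rV[R]_m) : x != 0 -> exists i, `|x ord0 i| = `|x|.
Proof.
rewrite -normr_eq0 => /mx_norm_neq0[[j i]] xE; exists i.
by rewrite (ord1 j) in xE; rewrite -xE.
Qed.

Lemma crosspolytope_norm x : crosspolytope x -> `|x| <= 1.
Proof.
move=> Kx; apply: norm_le_coord => // i; rewrite -[leRHS]Kx (bigD1 i)//=.
by rewrite lerDl sumr_ge0.
Qed.

Lemma crosspolytope_compact : compact crosspolytope.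
Proof.
apply: bounded_closed_compact.
  exists 1; split=> // M M1 x Kx /=.
  exact: (le_trans (crosspolytope_norm Kx) (ltW M1)).
rewrite (_ : crosspolytope = (fun x : V => \sum_i `|x ord0 i|) @^-1` [set 1])//.
apply: closed_comp; last exact: closed_eq.
move=> x _; apply: (continuous_big add_continuous) => i _ {}x.
by apply: (@continuous_comp _ R R); [exact: coord_continuous | exact: norm_continuous].
Qed.

Definition vertex (j : nat) : V := \row_i (val i == j)%:R.

(** The invariant of iterated subdivision. The common facet keeps every vertex on the
    cross-polytope, where the cochains are known to be odd. *)
Definition small_simplex d (D : R) s : Prop :=
  [/\ size s = d.+1, mesh_le D s &
      exists2 y, sign_vector y & {in s, forall x, face y x}].

Lemma small_simplex_piece d D s t : (d <= n)%N -> 0 <= D -> piece t s -> small_simplex d D s ->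
  small_simplex d ((1 - n.+1%:R^-1) * D) t.
Proof.
move=> dn D0 ts [sE sD [y y1 sy]]; split.
- by rewrite (size_piece ts).
- by apply: piece_mesh ts sD => //; rewrite sE ltnS.
- by exists y => //; apply: piece_bary_closed ts sy; exact: face_bary_closed.
Qed.

Lemma contraction_ge0 : 0 <= 1 - n.+1%:R^-1 :> R.
Proof. by rewrite subr_ge0 invf_le1 ?ler1n ?ltr0n. Qed.

(** The [m]-fold subdivision evaluates [c] only on simplices whose mesh has shrunk [m] times, so the
    values on small simplices decide the result. *)
Lemma eq_iter_subdiv d D m c c' s : (d <= n)%N -> 0 <= D -> small_simplex d D s ->
  (forall t, small_simplex d ((1 - n.+1%:R^-1) ^+ m * D) t -> c t = c' t) ->
  iter m (@subdiv _ _) c s = iter m (@subdiv _ _) c' s.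
Proof.
move=> dn; elim: m D s => [|m IHm] D s D0 sD eq_c /=.
  by apply: eq_c; rewrite mul1r.
apply: eq_subdiv => t ts; apply: IHm (small_simplex_piece dn D0 ts sD) _.
  by rewrite mulr_ge0// contraction_ge0.
by move=> t' t'D; apply: eq_c; rewrite exprSr -mulrA.
Qed.

(** Each simplex of the hemisphere lies in a facet of the cross-polytope, whose diameter is at most
    [2]. *)
Lemma eq_hemisphere_small d c c' : (d <= n)%N ->
  (forall s, small_simplex d 2 s -> c s = c' s) ->
  hemisphere vertex d c = hemisphere vertex d c'.
Proof.
move=> dn eq_c.
(* Strengthening for the induction: coordinates beyond [d] vanish, so the sign of the facet at
   coordinate [d + 1] is still free when the cone vertex is added. *)
have {}eq_c s : size s = d.+1 ->
    (exists2 y, sign_vector y & {in s, forall x, face y x /\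
      forall i : 'I_n.+1, (d < i)%N -> x ord0 i = 0}) -> c s = c' s.
  move=> sE [y y1 sy]; apply: eq_c; split=> //; last first.
    by exists y => // x /sy[].
  move=> u v us vs; apply: (le_trans (ler_normB _ _)).
  rewrite -[2]/(1 + 1) lerD// crosspolytope_norm//.
    by apply: (face_crosspolytope y1); have [] := sy _ us.
  by apply: (face_crosspolytope y1); have [] := sy _ vs.
elim: d dn c c' eq_c => [|d IHd] dn c c' eq_c /=.
  apply: eq_c => //; exists (const_mx 1) => [i|x]; first by rewrite mxE normr1.
  rewrite inE => /eqP ->; split; last by move=> i i0; rewrite mxE gtn_eqF.
  split=> [|i]; last by rewrite !mxE mul1r ler0n.
  rewrite (bigD1 ord0)//= !mxE/= mulr1 big1 ?addr0// => i i0.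
  by rewrite !mxE -[val i == _]/(i == ord0) (negbTE i0) mulr0.
(* Both cones at once, [a] being the identity or the antipodal map. *)
suff cone (a : {additive V -> V}) : (forall x, a x = x) \/ (forall x, a x = - x) ->
    hemisphere vertex d (fun t => c (vertex d.+1 :: map a t)) =
    hemisphere vertex d (fun t => c' (vertex d.+1 :: map a t)).
  have h1 := cone idfun (or_introl (fun=> erefl)).
  have h2 := cone -%R (or_intror (fun=> erefl)).
  congr (_ (+) _) => //; move: h1.
  have idE (b : seq V -> bool) : hemisphere vertex d (fun t => b (vertex d.+1 :: map idfun t)) =
      hemisphere vertex d (fun t => b (vertex d.+1 :: t)).
    by apply: eq_hemisphere => t _; rewrite map_id.
  by rewrite !idE.
move=> aE; apply: IHd (ltnW dn) _ _ _ => s sE [y y1 sy].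
apply: eq_c; first by rewrite /= size_map sE.
pose b : R := if `[< forall x, a x = x >] then 1 else -1.
have aE' x : a x = b *: x.
  rewrite /b; case: asboolP => [->|na]; first by rewrite scale1r.
  by case: aE => // ->; rewrite scaleN1r.
have b1 : b * b = 1 by rewrite /b; case: ifP; rewrite ?mulrNN mulr1.
(* The facet of the cone has sign [1] at the new vertex and elsewhere the signs of the old facet
   moved by [a]. *)
exists (\row_i if i == d.+1 :> nat then 1 else b * y ord0 i).
  move=> i; rewrite mxE; case: ifP; rewrite ?normr1// normrM y1 mulr1 /b.
  by case: ifP; rewrite ?normrN normr1.
move=> x; rewrite inE => /orP[/eqP->|/mapP[z zs ->]].
  split; last by move=> i di; rewrite mxE gtn_eqF.
  split=> [|i]; last by rewrite !mxE; case: ifP; rewrite ?mulr1 ?mulr0.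
  pose j : 'I_n.+1 := Ordinal (dn : (d.+1 < n.+1)%N).
  rewrite (bigD1 j)//= !mxE/= eqxx mulr1 big1 ?addr0// => i id.
  by rewrite !mxE -[val i == _]/(i == j) (negbTE id) mulr0.
have [[zy yz] z0] := sy z zs.
have E i : (\row_i if i == d.+1 :> nat then 1 else b * y ord0 i) ord0 i * a z ord0 i
    = y ord0 i * z ord0 i.
  rewrite aE' !mxE; case: ifP => [/eqP id|_]; first by rewrite z0 ?id// !mulr0.
  by rewrite mulrACA b1 mul1r.
split; first by split=> [|i]; [under eq_bigr do rewrite E | rewrite E].
by move=> i di; rewrite aE' !mxE z0 ?mulr0// ltnW.
Qed.

(* By induction on [d], moving the coboundary in [cup_coboundS] onto the chain. *)
Lemma hemisphere_cup (f : nat -> V -> bool) d m : (d <= n)%N ->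
  (forall i, (i < d)%N -> forall x, crosspolytope x -> f i (- x) = ~~ f i x) ->
  hemisphere vertex d (iter m (@subdiv _ _) (cup_cobound f d)) = true.
Proof.
elim: d => [|d IHd] dn f_odd.
  suff iterE c x : iter m (@subdiv _ _) c [:: x] = c [:: x] by rewrite /= iterE.
  by elim: (m) c => [//|m' IHm] c; rewrite iterSr IHm /subdiv/= addbF barycenter1.
have cobE c s : iter m (@subdiv _ _) (cobound c) s = cobound (iter m (@subdiv _ _) c) s.
  elim: (m) s => [//|m' IHm] s /=; rewrite -subdiv_cobound.
  by apply: eq_subdiv => t _; exact: IHm.
have oppE c s : iter m (@subdiv _ _) (fun t => c (map -%R t)) s =
    iter m (@subdiv _ _) c (map -%R s).
  elim: (m) s => [//|m' IHm] s /=; rewrite -subdivN.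
  by apply: eq_subdiv => t _; exact: IHm.
have addE c c' s : iter m (@subdiv _ _) (fun t => c t (+) c' t) s =
    iter m (@subdiv _ _) c s (+) iter m (@subdiv _ _) c' s.
  elim: (m) s => [//|m' IHm] s /=; rewrite -subdiv_addb.
  by apply: eq_subdiv => t _; exact: IHm.
pose c := cup0 (f d) (cup_cobound f d).
transitivity (hemisphere vertex d.+1 (cobound (iter m (@subdiv _ _) c))).
  apply: eq_hemisphere_small => // s sD; rewrite -cobE.
  apply: (eq_iter_subdiv dn _ sD) => // t [tE _ _].
  by rewrite cup_coboundS.
rewrite hemisphere_cobound -hemisphere_addb -(IHd (ltnW dn)); last first.
  by move=> i id; apply: f_odd; exact: ltnW.
apply: eq_hemisphere_small => [|s sD]; first exact: ltnW.
rewrite -oppE -addE; apply: (eq_iter_subdiv (ltnW dn) _ sD) => // t [tE _ [y y1 ty]].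
have tK x : x \in t -> crosspolytope x by move/ty/(face_crosspolytope y1).
have tN : cup_cobound f d (map -%R t) = cup_cobound f d t.
  by apply: cup_cobound_odd => i id x /tK; apply: f_odd; exact: ltnW.
(* As [f d] is odd and the cup product even, the values at [t] and at its antipode carry the
   coefficients [f d x] and [~~ f d x], which add up to [1]. *)
rewrite /c /cup0 tN; case: t tE tK {ty tN} => [//|x t] _ tK /=.
rewrite f_odd//; last by apply: tK; rewrite inE eqxx.
by case: (f d x); case: cup_cobound.
Qed.

End Crosspolytope.

(** * From cochains to continuous odd maps *)

Section BorsukUlam.
Variables (R : realType) (n : nat).
Local Notation V := 'rV[R]_n.+1.

Lemma small_simplex_mesh (e : R) : 0 < e ->
  exists m, forall s : seq V, small_simplex n ((1 - n.+1%:R^-1) ^+ m * 2) s -> mesh_le e s.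
Proof.
move=> e0; have : (1 - n.+1%:R^-1 : R) ^+ m * 2 @[m --> \oo] --> (0 * 2 : R).
  apply: cvgMl; apply: cvg_expr; rewrite ger0_norm ?contraction_ge0//.
rewrite mul0r => /cvgrPdist_lt/(_ _ e0)[m _ /(_ m (leqnn m))] /=.
rewrite sub0r normrN => me; exists m => s [_ sD _] x y xs ys.
by apply: (le_trans (sD x y xs ys)); apply: ltW; apply: le_lt_trans (ler_norm _) me.
Qed.

(** An odd choice of sign for nonzero vectors, since the same coordinate is picked for [x] and
    [- x]. It breaks ties where a coordinate of the map vanishes. *)
Definition leading_sign (x : V) : bool :=
  if [pick i | x ord0 i != 0] is Some i then 0 < x ord0 i else false.

Lemma leading_signN (x : V) : x != 0 -> leading_sign (- x) = ~~ leading_sign x.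
Proof.
move=> x0; rewrite /leading_sign.
rewrite (@eq_pick _ _ (fun i => x ord0 i != 0)); last first.
  by move=> i /=; rewrite mxE oppr_eq0.
case: pickP => [i|xi].
  by rewrite mxE oppr_gt0 => xi; rewrite -leNgt le_eqVlt (negbTE xi).
case/eqP: x0; apply/rowP => i; rewrite mxE; apply/eqP.
by have := xi i => /negbFE.
Qed.

(* On a small simplex some coordinate of [g] keeps a constant nonzero
   sign, so the cup product of the coboundaries of the signs vanishes there. *)
Theorem borsuk_ulam (g : V -> 'rV[R]_n) :
  (forall x : V, x != 0 -> g (- x) = - g x) ->
  (forall x : V, x != 0 -> {for x, continuous g}) ->
  exists2 x, crosspolytope x & g x = 0.
Proof.
move=> g_odd g_cont; apply: contrapT => /forall2NP g_neq0.
have {}g_neq0 x : crosspolytope x -> g x != 0.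
  by move=> Kx; case: (g_neq0 x) => // /eqP.
(* Some coordinate of [g] keeps the sign it has at [x] up to distance [e]. Compactness yields one
   [e] for all [x], in the manner of a Lebesgue number. *)
pose P (e : R) x := exists i : 'I_n, g x ord0 i != 0 /\
  forall y, `|x - y| <= e -> 0 < g x ord0 i * g y ord0 i.
have : \forall e \near 0^'+, @crosspolytope R n `<=` P e.
  have /compact_near_coveringP := @crosspolytope_compact R n; apply.
  move=> x Kx; have [i gi] := norm_attained (g_neq0 x Kx).
  have gi0 : 0 < `|g x ord0 i| by rewrite gi normr_gt0 g_neq0.
  have ci : {for x, continuous (fun z => g z ord0 i)}.
    apply: (@continuous_comp V 'rV[R]_n R g (fun M : 'rV[R]_n => M ord0 i)).
      by apply: g_cont; exact: crosspolytope_neq0.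
    exact: coord_continuous.
  have /cvgrPdist_lt/(_ _ gi0) := ci.
  move/nbhs_ballP => [r /= r0 xr].
  near=> z e => /=.
  have near_x w : `|x - w| < r -> 0 < g x ord0 i * g w ord0 i.
    move=> xw; have := xr w; rewrite -ball_normE/= => /(_ xw).
    move: gi0; rewrite normr_gt0 => gi0'.
    case: (ltgtP (g x ord0 i) 0) gi0' => // gx _.
      rewrite (ltr0_norm gx) ltr_norml => /andP[]; rewrite opprK => h _.
      by rewrite nmulr_rgt0// -subr_gt0 ltrBrDr addrC; lra.
    rewrite (gtr0_norm gx) ltr_norml => /andP[_ h].
    by rewrite pmulr_rgt0//; lra.
  have xz : `|x - z| < r / 2.
    near: z; apply/nbhs_ballP; exists (r / 2); first by rewrite /= divr_gt0.
    by move=> w; rewrite -ball_normE.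
  have gz := near_x z (lt_trans xz _); exists i; split.
    by apply: contraTneq (gz _) => [->|]; rewrite ?mulr0 ?ltxx//; lra.
  move=> y zy; have gy : 0 < g x ord0 i * g y ord0 i.
    apply: near_x; rewrite -(subrK z x) -addrA (le_lt_trans (ler_normD _ _))//.
    have er : e < r / 2 by near: e; apply: nbhs_right_lt; rewrite divr_gt0.
    lra.
  have {gz}gz : 0 < g x ord0 i * g z ord0 i by apply: gz; lra.
  have := mulr_gt0 gz gy; rewrite mulrACA -expr2 pmulr_rgt0// exprn_even_gt0//=.
  by rewrite -normr_gt0.
move=> eP; near ((0 : R)^'+) => e.
have Pe : @crosspolytope R n `<=` P e by near: e.
have e0 : 0 < e by [].
have [m mP] := small_simplex_mesh e0.
pose f i x := if insub i is Some j then
  if g x ord0 j == 0 then leading_sign x else 0 < g x ord0 j else false.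
have f_odd i : (i < n)%N -> forall x, crosspolytope x -> f i (- x) = ~~ f i x.
  move=> ni x /crosspolytope_neq0 x0; rewrite /f insubT/= g_odd// mxE oppr_eq0.
  case: eqP => [_|/eqP gx]; first exact: leading_signN.
  by rewrite oppr_gt0 -leNgt le_eqVlt (negbTE gx).
(* Oddness makes the sum over the hemisphere [true], while the cochain vanishes on each simplex of
   the subdivision. *)
have := @hemisphere_cup R n f n m (leqnn n) f_odd.
have hem0 v d : @hemisphere R V v d (fun=> false) = false by elim: d => //= d ->.
rewrite (@eq_hemisphere_small _ _ _ _ (fun=> false)) ?hem0//.
move=> s s2; transitivity (iter m (@subdiv _ _) (fun=> false) s).
  apply: (eq_iter_subdiv (leqnn n) _ s2) => // -[|x t] tD; first by case: tD.
  have [tE _ [y y1 ty]] := tD.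
  have [|i [gi xi]] := Pe x.
    by apply: (face_crosspolytope y1); apply: ty; rewrite inE eqxx.
  apply: (cup_cobound_const (ltn_ord i) tE).
  have fx z : z \in x :: t -> f i z = (0 < g x ord0 i).
    move=> zt; have xz := xi z (mP _ tD x z (mem_head _ _) zt).
    rewrite /f valK; have -> : (g z ord0 i == 0) = false.
      by apply: contraTF xz => /eqP ->; rewrite mulr0 ltxx.
    move: gi xz; case: (ltgtP (g x ord0 i) 0) => // gx _.
      by rewrite nmulr_rgt0// => /lt_gtF ->.
    by rewrite pmulr_rgt0.
  by move=> z w zt wt; rewrite !fx.
elim: m {mP} s {s2} => [//|m IHm] s /=.
rewrite (eq_subdiv (c' := fun=> false)) => [|t _]; last exact: IHm.
have cobound0 t : cobound (fun=> false) t = false :> bool by elim: t.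
rewrite /subdiv; move: (size s) => k; elim: k s => [//|k IHk] s /=.
by rewrite -[RHS](cobound0 _ s); apply: eq_cobound => t _ _; exact: IHk.
Unshelve. all: by end_near. Qed.

End BorsukUlam.

(** * Odd maps with a sign on the preimage of the unit ball *)

Lemma row_continuous (R : realType) (T : topologicalType) n
    (f : T -> 'rV[R]_n) (x : T) :
  (forall i, {for x, continuous (fun y => f y ord0 i)}) -> {for x, continuous f}.
Proof.
move=> f_cont; suff : f y @[y --> x] --> f x by [].
apply/(@cvgrPdist_le _ 'rV[R]_n _ (nbhs x)) => e e0.
have : \forall y \near x, forall i, `|f x ord0 i - f y ord0 i| <= e.
  apply: filter_forall => i.
  by have /(@cvgrPdist_le _ R _ (nbhs x))/(_ _ e0) := f_cont i.
apply: filterS => y fy; apply: norm_le_coord => [|i]; first exact: ltW.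
by rewrite !mxE; exact: fy.
Qed.

Section OddImage.
Variables (R : realType) (n : nat).
Local Notation V := 'rV[R]_n.+1.
Variables (phi : V -> 'rV[R]_n) (sg : V -> R) (c : 'rV[R]_n).
Hypothesis c1 : `|c| = 1.
Hypothesis phi_odd : forall x : V, x != 0 -> phi (- x) = - phi x.
Hypothesis phi_cont : forall x : V, x != 0 -> {for x, continuous phi}.
Hypothesis sg_odd : forall x : V, sg (- x) = - sg x.
Hypothesis sg_le1 : forall x : V, `|sg x| <= 1.
Hypothesis sg1 : forall x : V, x != 0 -> `|phi x| < 1 -> `|sg x| = 1.
Hypothesis sg_cont :
  forall x : V, x != 0 -> `|phi x| < 1 -> {for x, continuous sg}.

(** [sg] is controlled only where [|phi| < 1]; the second factor vanishes elsewhere and makes the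
    product continuous off the origin. *)
Let b (x : V) := sg x * Num.max 0 (1 - `|phi x|).

(** Where [|phi x| < 1] both factors are continuous. Otherwise [b x = 0] and [|b y| <= max(0, 1 -
    |phi y|) <= |phi x - phi y|]. *)
Let b_cont (x : V) : x != 0 -> {for x, continuous b}.
Proof.
move=> x0; have phix := phi_cont x0.
have [phi1|phi1] := ltP `|phi x| 1.
  have phi1' : \forall y \near x, `|phi y| < 1.
    have r0 : 0 < 1 - `|phi x| by rewrite subr_gt0.
    have /cvgrPdist_lt/(_ _ r0) := phix; apply: filterS => y xy.
    have := ler_normD (phi x) (phi y - phi x); rewrite addrC subrK distrC.
    by move=> h; lra.
  have bE : {near x, (fun y => sg y * (1 - `|phi y|)) =1 b}.
    by apply: filterS phi1' => y phiy; rewrite /b max_r// subr_ge0 ltW.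
  suff : b y @[y --> x] --> sg x * (1 - `|phi x|).
    by rewrite (nbhs_singleton bE).
  apply: (cvg_trans (near_eq_cvg bE)).
  apply: cvgM; first exact: sg_cont.
  by apply: cvgB; [exact: cvg_cst | exact: cvg_norm].
suff : b y @[y --> x] --> b x by [].
apply/(@cvgrPdist_lt _ R _ (nbhs x)) => e e0; move/cvgrPdist_lt/(_ _ e0): phix.
apply: filterS => y xy; rewrite [b x]/b max_l ?subr_le0// mulr0 sub0r normrN.
rewrite normrM; apply: (@le_lt_trans _ _ `|Num.max 0 (1 - `|phi y|)|).
  by rewrite ler_piMl.
rewrite ger0_norm ?le_max ?lexx// gt_max e0 /=; apply: le_lt_trans xy.
by apply: le_trans (ler_dist_dist _ _); apply: le_trans (ler_norm _); lra.
Qed.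

Lemma odd_ray_image (k : R) : 0 <= k ->
  exists2 x, crosspolytope x & phi x = (k / (1 + k)) *: c.
Proof.
move=> k0.
have [|x x0|x Kx] := @borsuk_ulam R n (fun x => phi x - (k * b x) *: c).
- move=> x x0; rewrite /b phi_odd// sg_odd normrN.
  by rewrite mulNr mulrN scaleNr opprB opprK addrC.
- suff : phi y - (k * b y) *: c @[y --> x] --> phi x - (k * b x) *: c by [].
  have phix : phi y @[y --> x] --> phi x by exact: phi_cont.
  have bx : b y @[y --> x] --> b x by exact: b_cont.
  apply: (@cvgB _ _ _ (nbhs x)) => //.
  by apply: (@cvgZr_tmp _ _ _ (nbhs x)); apply: (@cvgMr _ _ (nbhs x)).
move/eqP; rewrite subr_eq0 => /eqP phixE.
have x0 := crosspolytope_neq0 Kx.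
(* At a zero with [|phi x| >= 1] the correction vanishes, so [phi x = 0], which is absurd. *)
have [phi1|phi1] := ltP `|phi x| 1; last first.
  have : phi x = 0.
    by rewrite phixE /b [Num.max _ _]max_l ?subr_le0// mulr0 mulr0 scale0r.
  by move=> h; move: phi1; rewrite h normr0 ler10.
have bE : b x = sg x * (1 - `|phi x|) by rewrite /b max_r// subr_ge0 ltW.
(* Taking norms gives a linear equation for [|phi x|], with solution [k / (1 + k)]. *)
have nE : `|phi x| = k * (1 - `|phi x|).
  rewrite {1}phixE normrZ c1 mulr1 normrM (ger0_norm k0) bE normrM sg1// mul1r.
  by rewrite ger0_norm// subr_ge0 ltW.
have mE : k * (1 - `|phi x|) = k / (1 + k).
  have k1 : 1 + k != 0 by rewrite gt_eqF//; lra.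
  rewrite -nE; apply: (mulIf k1); rewrite divfK//; lra.
(* [sg x] is [1] or [-1]; in the second case the antipode is the solution. *)
have := sg1 x0 phi1; case: (ger0P (sg x)) => _ sgE.
  by exists x => //; rewrite phixE bE sgE mul1r mE.
exists (- x); first exact: crosspolytopeN.
by rewrite phi_odd// phixE bE -scaleNr -mulrN -mulNr sgE mul1r mE.
Qed.

(** If [c] were omitted on the cross-polytope, then near each [x] and for all large [k] so would be
    [k / (1 + k) c], which tends to [c]. By compactness one [k] serves all [x], against
    [odd_ray_image]. *)
Lemma odd_image : exists2 x, crosspolytope x & phi x = c.
Proof.
apply: contrapT => /forall2NP phi_neqc.
have : \forall k \near \oo, @crosspolytope R n `<=`
    [set x | phi x != (k%:R / (1 + k%:R)) *: c].
  have /compact_near_coveringP := @crosspolytope_compact R n; apply.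
  move=> x Kx; have /eqP xc : phi x <> c by case: (phi_neqc x).
  pose r := `|phi x - c| / 2.
  have r0 : 0 < r by rewrite divr_gt0// normr_gt0 subr_eq0.
  have /cvgrPdist_lt/(_ _ r0) xr := phi_cont (crosspolytope_neq0 Kx).
  have cr : \forall k \near \oo, `|c - (k%:R / (1 + k%:R)) *: c| < r.
    have /cvgrPdist_lt/(_ _ r0) := @cvg_harmonic R.
    apply: filterS => k; rewrite sub0r normrN => hr.
    have -> : c - (k%:R / (1 + k%:R)) *: c = k.+1%:R^-1 *: c.
      rewrite -{1}[c]scale1r -scalerBl; congr (_ *: _).
      rewrite nat1r -[k.+1%:R in RHS]nat1r; field.
      by rewrite nat1r pnatr_eq0.
    by rewrite normrZ c1 mulr1.
  near=> y k; apply/eqP => yE.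
  have yr : `|phi x - phi y| < r by near: y.
  have : `|c - (k%:R / (1 + k%:R)) *: c| < r by near: k.
  rewrite -yE => ycr; have := ler_distD (phi y) (phi x) c.
  rewrite (distrC (phi y) c) => h.
  have : `|phi x - c| = r + r by rewrite /r -splitr.
  by move=> E; rewrite E in h; lra.
move=> [k _ /(_ k (leqnn k))] /= cover.
have [x Kx xE] := @odd_ray_image k%:R (ler0n _ _).
by have := cover x Kx; rewrite /= xE eqxx.
Unshelve. all: by end_near. Qed.

End OddImage.

(** * Measures of half-spaces *)

Lemma nbhs_set_type (T : topologicalType) (A : set T) (x : A) (U : set A) :
  nbhs x U <->
  exists B : set T, [/\ open B, B (val x) & forall y : A, B (val y) -> U y].
Proof.
split=> [[_ /= [[W oW <-] /= Wx WU]]|[B [oB Bx BU]]].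
  by exists W; split=> // y; exact: WU.
by exists (val @^-1` B); split=> //; exists B.
Qed.

Lemma cvg_set_type (S T : topologicalType) (A : set T) (f : S -> A) (x : S) :
  val (f y) @[y --> x] --> val (f x) -> f y @[y --> x] --> f x.
Proof.
move=> fx U /nbhs_set_type[B [oB Bfx BU]].
apply: (@filterS _ (nbhs x) _ [set y | B (val (f y))]) => [y /BU//|].
exact: (fx B (open_nbhs_nbhs (conj oB Bfx))).
Qed.

Lemma near_neq0 (R : realType) (U : normedModType R) (x : U) :
  x != 0 -> \forall y \near x, y != 0.
Proof.
rewrite -normr_eq0 => x0; have : \forall y \near x, `|y| != 0.
  exact: (@norm_continuous _ U x [set e | e != 0]
    (open_nbhs_nbhs (conj (@open_neq R 0) x0))).
by apply: filterS => y; rewrite normr_eq0.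
Qed.

(** * Euclidean scalar product and normalization of vectors *)

Section Dot.
Variables (R : realType) (n : nat).
Local Notation V := 'rV[R]_n.
Implicit Types (v x : V) (u : sphere R n) (t a : R).

Lemma dotC v x : dot v x = dot x v.
Proof. by apply: eq_bigr => i _; rewrite mulrC. Qed.

Lemma dotZr a v x : dot v (a *: x) = a * dot v x.
Proof. by rewrite /dot mulr_sumr; apply: eq_bigr => i _; rewrite mxE mulrCA. Qed.

Lemma dotZl a v x : dot (a *: v) x = a * dot v x.
Proof. by rewrite dotC dotZr dotC. Qed.

Lemma dotNl v x : dot (- v) x = - dot v x.
Proof. by rewrite -scaleN1r dotZl mulN1r. Qed.

Lemma dotNr v x : dot v (- x) = - dot v x.
Proof. by rewrite dotC dotNl dotC. Qed.

Lemma dotDr v x y : dot v (x + y) = dot v x + dot v y.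
Proof. by rewrite /dot -big_split; apply: eq_bigr => i _; rewrite mxE mulrDr. Qed.

Lemma dotBr v x y : dot v (x - y) = dot v x - dot v y.
Proof. by rewrite dotDr dotNr. Qed.

Lemma dot0l x : dot 0 x = 0.
Proof. by rewrite /dot big1// => i _; rewrite mxE mul0r. Qed.

Lemma dot_ge0 v : 0 <= dot v v.
Proof. by apply: sumr_ge0 => i _; rewrite -expr2 sqr_ge0. Qed.

Lemma dot_eq0 v : dot v v = 0 -> v = 0.
Proof.
move/eqP; rewrite psumr_eq0 => [/allP v0|i _]; last by rewrite -expr2 sqr_ge0.
apply/rowP => i; rewrite mxE; apply/eqP.
by have := v0 i (mem_index_enum i); rewrite mulf_eq0 orbb.
Qed.

Lemma dot_gt0 v : v != 0 -> 0 < dot v v.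
Proof.
by move=> v0; rewrite lt0r dot_ge0 andbT; apply: contra_neq v0; exact: dot_eq0.
Qed.

Lemma dot_unit u : dot (val u) (val u) = 1.
Proof. by case: u => u /= /set_mem. Qed.

Lemma dot_norm v x : `|dot v x| <= n%:R * `|v| * `|x|.
Proof.
apply: (le_trans (ler_norm_sum _ _ _)).
apply: (@le_trans _ _ (\sum_(i < n) `|v| * `|x|)).
  by apply: ler_sum => i _; rewrite normrM ler_pM// coord_norm_le.
by rewrite big_const_ord iter_addr_0 -mulrA mulr_natl.
Qed.

Lemma dot_pair_continuous : continuous (fun q : V * V => dot q.1 q.2).
Proof.
apply: (continuous_big add_continuous) => i _ q.
apply: (@cvgM _ _ (nbhs q)).
  apply: (@continuous_comp _ _ _ fst (fun v : V => v ord0 i)).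
    exact: cvg_fst.
  exact: coord_continuous.
apply: (@continuous_comp _ _ _ snd (fun v : V => v ord0 i)).
  exact: cvg_snd.
exact: coord_continuous.
Qed.

Lemma dot_continuous v : continuous (dot v).
Proof.
move=> x; apply: (@continuous_comp _ _ _ (pair v) (fun q : V * V => dot q.1 q.2)).
  by apply: (@cvg_pair _ _ _ (nbhs x) (nbhs v) (nbhs x)); [exact: cvg_cst | exact: cvg_id].
exact: dot_pair_continuous.
Qed.

Lemma dot_self_continuous : continuous (fun v => dot v v).
Proof.
move=> x; apply: (@continuous_comp _ _ _ (fun v => (v, v)) (fun q : V * V => dot q.1 q.2)).
  by apply: (@cvg_pair _ _ _ (nbhs x) (nbhs x) (nbhs x)); exact: cvg_id.
exact: dot_pair_continuous.
Qed.

Lemma sphere_opp_subproof u : - val u \in sphere R n.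
Proof. by apply/mem_set; rewrite /sphere/= dotNl dotNr opprK dot_unit. Qed.

Definition sphere_opp u : sphere R n :=
  @exist V (fun x => x \in sphere R n) (- val u) (sphere_opp_subproof u).

Lemma unit_vector_subproof (n_gt0 : (0 < n)%N) :
  (delta_mx ord0 (Ordinal n_gt0) : V) \in sphere R n.
Proof.
apply/mem_set; rewrite /sphere/= /dot (bigD1 (Ordinal n_gt0))//= !mxE !eqxx mulr1.
by rewrite big1 ?addr0// => i i0; rewrite !mxE (negbTE i0) andbF mulr0.
Qed.

Definition unit_vector (n_gt0 : (0 < n)%N) : sphere R n :=
  @exist V (fun x => x \in sphere R n) _ (unit_vector_subproof n_gt0).

Definition enorm v : R := Num.sqrt (dot v v).

Lemma enorm_gt0 v : v != 0 -> 0 < enorm v.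
Proof. by move=> v0; rewrite sqrtr_gt0 dot_gt0. Qed.

Lemma enormN v : enorm (- v) = enorm v.
Proof. by rewrite /enorm dotNl dotNr opprK. Qed.

Lemma enorm_continuous : continuous enorm.
Proof.
by move=> v; apply: continuous_comp; [exact: dot_self_continuous | exact: sqrt_continuous].
Qed.

Variable u0 : sphere R n.

(** [u0] is the value at [v = 0], where there is no direction. *)
Definition normalize v : sphere R n := insubd u0 ((enorm v)^-1 *: v).

Lemma val_normalize v : v != 0 -> val (normalize v) = (enorm v)^-1 *: v.
Proof.
move=> v0; rewrite val_insubd mem_set// /sphere/= dotZl dotZr mulrA -expr2.
by rewrite exprVn sqr_sqrtr ?dot_ge0// mulVf// gt_eqF// dot_gt0.
Qed.

Lemma normalizeN v : v != 0 -> normalize (- v) = sphere_opp (normalize v).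
Proof.
by move=> v0; apply: val_inj; rewrite /= !val_normalize ?oppr_eq0// enormN scalerN.
Qed.

Lemma normalize_cvg v : v != 0 -> {for v, continuous normalize}.
Proof.
move=> v0; apply: cvg_set_type; rewrite val_normalize//.
have e0 : enorm v != 0 by rewrite gt_eqF// enorm_gt0.
have near_v : {near v, (fun w => val (normalize w)) =1 (fun w => (enorm w)^-1 *: w)}.
  by apply: filterS (near_neq0 v0) => w; exact: val_normalize.
have near_v' : {near v, (fun w => (enorm w)^-1 *: w) =1 (fun w => val (normalize w))}.
  by apply: filterS near_v => w ->.
apply: (cvg_trans (near_eq_cvg near_v')).
apply: (@cvgZ _ _ _ (nbhs v)) => //.
by apply: (@cvgV _ _ (nbhs v)) => //; exact: enorm_continuous.
Qed.

End Dot.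

Section HalfspaceMeasure.
Variables (R : realType) (n : nat).
Local Notation V := 'rV[R]_n.
Variable mu : probability (g_sigma_algebraType (@open V)) R.
Implicit Types (v x : V) (u : sphere R n) (t a : R).

(** The normal may have any length. For [v = 0] the set is empty or the whole space, which adds two
    poles to the space of half-spaces. *)
Definition upper_halfspace (v : V) (t : R) : set V := [set x | t <= dot v x].

Lemma closed_measurable (A : set V) : closed A ->
  measurable (A : set (g_sigma_algebraType (@open V))).
Proof.
move=> cA; rewrite -[A]setCK; apply: measurableC.
by apply: sub_sigma_algebra; rewrite openC.
Qed.

Lemma open_measurableV (A : set V) : open A ->
  measurable (A : set (g_sigma_algebraType (@open V))).
Proof. by move=> oA; exact: sub_sigma_algebra. Qed.

Lemma upper_halfspace_closed v t : closed (upper_halfspace v t).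
Proof.
apply: (@closed_comp _ _ (dot v) [set x | t <= x]); last exact: closed_ge.
by move=> x _; exact: dot_continuous.
Qed.

Lemma upper_halfspace_scale (a : R) v t : 0 < a -> upper_halfspace (a *: v) (a * t) = upper_halfspace v t.
Proof. by move=> a0; apply/seteqP; split=> x; rewrite /upper_halfspace/= dotZl ler_pM2l. Qed.

(* If [K] were not negligible, the sets with negligible complement in [K] would
   form a proper filter, whose cluster points in [K] contradict the hypothesis. *)
Lemma compact_negligible (K : set V) : compact K ->
  (forall x, K x -> exists U, [/\ open U, U x & mu U = 0%E]) -> mu.-negligible K.
Proof.
move=> cK K0; apply: contrapT => Kneg.
pose F : set_system V := [set A | mu.-negligible (K `\` A)].
have FF : ProperFilter F.
  apply: Build_ProperFilter_ex => [A FA|].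
    apply: contrapT => /forallNP A0; apply: Kneg; apply: negligibleS FA => x Kx.
    by split=> //; exact: A0.
  split=> [|A B FA FB|A B AB]; rewrite /F/=.
  - by rewrite setDT; exact: negligible_set0.
  - by rewrite setDIr; exact: negligibleU.
  - by apply: negligibleS; exact: setDS.
have [p [Kp pF]] := cK F FF (ltac:(by rewrite /F/= setDv; exact: negligible_set0)).
have [U [oU Up U0]] := K0 p Kp.
have FU : F (~` U).
  have Uneg : mu.-negligible U by exists U; split=> //; exact: open_measurableV.
  by rewrite /F/= setDE setCK; apply: negligibleS Uneg => x [].
by have [x []] := pF _ _ FU (open_nbhs_nbhs (conj oU Up)).
Qed.

(** A half-space far out misses the support. Cut by balls, it is a countable union of compact sets
    whose points have null open neighbourhoods. *)
Lemma compact_support_halfspace u : compact (Defs.support mu) ->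
  exists M, forall t, M <= t -> mu (halfspace u t) = 0%E.
Proof.
move=> /compact_bounded[M [_ Mb]].
pose B := `|M| + 1.
have supB x : Defs.support mu x -> `|x| <= B.
  by apply: Mb; rewrite /B ltr_pwDr// ler_norm.
exists (n%:R * `|val u| * B + 1) => t tB.
apply: measure_negligible; first by apply: closed_measurable; exact: upper_halfspace_closed.
pose K k : set V := halfspace u t `&` [set x | `|x| <= k%:R].
suff Kneg : mu.-negligible (\bigcup_k K k).
  apply: negligibleS Kneg => x xt; exists (Num.bound `|x|) => //; split=> //=.
  by apply: ltW; apply: archi_boundP.
apply: negligible_bigcup => k; apply: compact_negligible.
  apply: bounded_closed_compact.
    exists k%:R; split=> // r kr x [_ /= xk]; exact: le_trans xk (ltW kr).
  apply: closedI; first exact: upper_halfspace_closed.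
  apply: (@closed_comp _ _ (fun x : V => `|x|) [set x | x <= k%:R]); last exact: closed_le.
  by move=> x _; exact: norm_continuous.
move=> x [xt _]; apply: contrapT => /forallNP xU.
have xsup : Defs.support mu x.
  move=> U oU Ux; rewrite lt0e measure_ge0 andbT; apply/eqP => U0.
  by apply: (xU U).
have := le_trans tB xt; have := le_trans (ler_norm _) (dot_norm (val u) x).
have : n%:R * `|val u| * `|x| <= n%:R * `|val u| * B.
  by rewrite ler_wpM2l ?mulr_ge0// supB.
by move=> h1 h2 h3; lra.
Qed.

Hypothesis mu_cont : continuous_measure mu.

Lemma sphere_line_continuous (u : sphere R n) :
  continuous (fun t : R => mu (halfspace u t)).
Proof.
move=> t; apply: (@continuous_comp _ _ _ (fun t => (u, t))
  (fun H => mu (halfspace H.1 H.2))).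
  by apply: (@cvg_pair _ _ _ (nbhs t) (nbhs u) (nbhs t)); [exact: cvg_cst | exact: cvg_id].
exact: mu_cont.
Qed.

(** Hyperplanes are null: the open half-space is the increasing union of the closed ones at
    [t + 1/(k+1)], whose measures tend to that of [halfspace u t] by continuity in [t]. *)
Lemma halfspace_open_measure u t : mu [set x | t < dot (val u) x] = mu (halfspace u t).
Proof.
have -> : [set x | t < dot (val u) x] = \bigcup_k halfspace u (t + k.+1%:R^-1).
  apply/seteqP; split=> [x /= tx|x [k _ /=]].
    exists (Num.bound (dot (val u) x - t)^-1) => //.
    rewrite /halfspace/= -lerBrDl -[leRHS]invrK lef_pV2 ?posrE ?ltr0n//.
      rewrite ltW// (lt_trans (archi_boundP _))// ?invr_ge0 ?subr_ge0 ?ltW//.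
      by rewrite ltr_nat.
    by rewrite invr_gt0 subr_gt0.
  by apply: lt_le_trans; rewrite ltrDl invr_gt0 ltr0n.
pose f := mu \o (fun k : nat => halfspace u (t + k.+1%:R^-1)).
have f1 : f k @[k --> \oo] --> mu (\bigcup_k halfspace u (t + k.+1%:R^-1)).
  apply: nondecreasing_cvg_mu.
  - by move=> k; apply: closed_measurable; exact: upper_halfspace_closed.
  - by apply: bigcup_measurable => k _; apply: closed_measurable; exact: upper_halfspace_closed.
  - move=> k m km; apply/subsetPset => x; apply: le_trans.
    by rewrite lerD2l lef_pV2 ?posrE ?ltr0n// ler_nat ltnS.
have f2 : f k @[k --> \oo] --> mu (halfspace u t).
  have tk : t + k.+1%:R^-1 @[k --> \oo] --> t + (0 : R).
    by apply: cvgD; [exact: cvg_cst | exact: cvg_harmonic].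
  rewrite addr0 in tk.
  exact: (@cvg_comp _ _ _ (fun k => t + k.+1%:R^-1) (fun t => mu (halfspace u t)) _
    (nbhs t) _ tk (@sphere_line_continuous u t)).
exact: (cvg_unique _ f1 f2).
Qed.

Lemma halfspace_opp u t :
  mu (halfspace (sphere_opp u) (- t)) = (1 - mu (halfspace u t))%E.
Proof.
rewrite -(halfspace_open_measure u t) -probability_setC; last first.
  apply: open_measurableV.
  apply: (@open_comp _ _ (dot (val u)) [set x | t < x]); last exact: open_gt.
  by move=> x _; exact: dot_continuous.
congr (mu _); apply/seteqP; split=> x; rewrite /halfspace/= dotNl lerN2 => h.
  by apply/negP; rewrite -leNgt.
by rewrite leNgt; apply/negP.
Qed.

End HalfspaceMeasure.

(** * Half-spaces in homogeneous coordinates *)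

Section HomogeneousCoordinates.
Variables (R : realType) (n : nat).
Local Notation V := 'rV[R]_n.
Local Notation W := 'rV[R]_(1 + n).
Implicit Types (w : W).

(* [w = (off w, dir w)] stands for the half-space [{x | off w <= dir w . x}]. *)
Definition dir (w : W) : V := rsubmx w.
Definition off (w : W) : R := w ord0 ord0.

Lemma dirN w : dir (- w) = - dir w.
Proof. by apply/rowP => i; rewrite !mxE. Qed.

Lemma offN w : off (- w) = - off w.
Proof. by rewrite /off mxE. Qed.

Lemma off_neq0 w : w != 0 -> dir w = 0 -> off w != 0.
Proof.
move=> w0 dw; apply: contraNneq w0 => ow; apply/eqP.
rewrite -[w]hsubmxK [rsubmx w]dw (_ : lsubmx w = 0) ?row_mx0//.
by apply/rowP => i; rewrite !mxE -[RHS]ow (ord1 i); congr (w _ _); exact: val_inj.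
Qed.

Lemma dir_continuous : continuous dir.
Proof. exact: continuous_rsubmx. Qed.

Lemma off_continuous : continuous off.
Proof. exact: coord_continuous. Qed.

Lemma near_dir_neq0 w : dir w != 0 -> \forall y \near w, dir y != 0.
Proof.
by move=> w0; exact: (@dir_continuous w _ (near_neq0 w0)).
Qed.

Variables (mu : probability (g_sigma_algebraType (@open V)) R) (u0 : sphere R n).
Hypothesis mu_cont : continuous_measure mu.

Definition hdir w : sphere R n := normalize u0 (dir w).
Definition hoff w : R := (enorm (dir w))^-1 * off w.

Lemma upper_halfspace_halfspace w : dir w != 0 ->
  upper_halfspace (dir w) (off w) = halfspace (hdir w) (hoff w).
Proof.
move=> w0; rewrite -[RHS]/(upper_halfspace (val (hdir w)) (hoff w)) val_normalize//.
by rewrite upper_halfspace_scale// invr_gt0 enorm_gt0.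
Qed.

Lemma hdirN w : dir w != 0 -> hdir (- w) = sphere_opp (hdir w).
Proof. by move=> w0; rewrite /hdir dirN normalizeN. Qed.

Lemma hoffN w : hoff (- w) = - hoff w.
Proof. by rewrite /hoff dirN enormN offN mulrN. Qed.

Lemma hdir_continuous w : dir w != 0 -> {for w, continuous hdir}.
Proof.
by move=> w0; apply: continuous_comp; [exact: dir_continuous | exact: normalize_cvg].
Qed.

Lemma hoff_continuous w : dir w != 0 -> {for w, continuous hoff}.
Proof.
move=> w0; apply: (@cvgM _ _ (nbhs w)); last exact: off_continuous.
apply: (@cvgV _ _ (nbhs w)); first by rewrite gt_eqF// enorm_gt0.
by apply: continuous_comp; [exact: dir_continuous | exact: enorm_continuous].
Qed.

Definition mass w : R := fine (mu (upper_halfspace (dir w) (off w))).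

Lemma upper_halfspace_measurable v t :
  measurable (upper_halfspace v t : set (g_sigma_algebraType (@open V))).
Proof. by apply: closed_measurable; exact: upper_halfspace_closed. Qed.

Lemma massE w : mu (upper_halfspace (dir w) (off w)) = (mass w)%:E.
Proof.
by rewrite fineK// fin_num_measure//; exact: upper_halfspace_measurable.
Qed.

Lemma mass_pole w : dir w = 0 -> 0 < off w -> mass w = 0.
Proof.
move=> dw ow; rewrite /mass (_ : upper_halfspace _ _ = set0) ?measure0//.
by rewrite -subset0 => x; rewrite /upper_halfspace/= dw dot0l leNgt ow.
Qed.

(** This makes [mass - 1/2] odd. At a pole one of the two sets is empty and the other is the whole
    space. *)
Lemma massN w : w != 0 -> mass (- w) = 1 - mass w.
Proof.
move=> w0; have [dw|dw] := eqVneq (dir w) 0; last first.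
  rewrite /mass !upper_halfspace_halfspace ?dirN ?oppr_eq0// hdirN// hoffN.
  by rewrite halfspace_opp// -upper_halfspace_halfspace// massE.
have h w' : dir w' = 0 -> 0 < off w' -> mass (- w') = 1 - mass w'.
  move=> dw' ow'; rewrite (mass_pole dw' ow') subr0 /mass.
  rewrite (_ : upper_halfspace _ _ = setT) ?probability_setT//.
  by apply/seteqP; split=> // x _; rewrite /upper_halfspace/= dirN offN dw' oppr0 dot0l oppr_le0 ltW.
have := off_neq0 w0 dw; case: ltgtP => // ow _; last exact: h.
have := h (- w); rewrite opprK dirN offN oppr_gt0 dw oppr0 => /(_ erefl ow) ->.
by rewrite opprB addrC subrK.
Qed.

Lemma norm_ge_measurable (a : R) :
  measurable ([set x : V | a <= `|x|] : set (g_sigma_algebraType (@open V))).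
Proof.
apply: closed_measurable.
apply: (@closed_comp _ _ (fun x : V => `|x|) [set x | a <= x]).
  by move=> x _; exact: norm_continuous.
exact: closed_ge.
Qed.

Lemma norm_far_cvg :
  mu [set x : V | k%:R <= `|x|] @[k --> \oo] --> 0%E.
Proof.
pose A k := [set x : V | k%:R <= `|x|].
have mA k : measurable (A k : set (g_sigma_algebraType (@open V))).
  exact: norm_ge_measurable.
have <- : mu (\bigcap_k A k) = 0%E.
  rewrite (_ : \bigcap_k _ = set0) ?measure0// -subset0 => x xA.
  have := xA (Num.bound `|x|) I; rewrite /A/= leNgt.
  by move/negP; apply; apply: archi_boundP.
apply: nonincreasing_cvg_mu => //.
- by apply: le_lt_trans (probability_le1 mu (mA 0%N)) _; exact: ltry.
- exact: bigcapT_measurable.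
- by move=> k m km; apply/subsetPset => x; apply: le_trans; rewrite ler_nat.
Qed.

(** Off the poles this is continuity of [mu] in normalized coordinates. Near the pole with
    [off w > 0] the half-spaces lie far from the origin, where little mass is left; the other pole
    follows by [massN]. *)
Lemma mass_continuous w : w != 0 -> {for w, continuous mass}.
Proof.
move=> w0; have [dw|dw] := eqVneq (dir w) 0; last first.
  pose g w := mu (halfspace (hdir w) (hoff w)).
  have near_w : {near w, (fine \o g) =1 mass}.
    by apply: filterS (near_dir_neq0 dw) => w' w'0; rewrite /g /mass upper_halfspace_halfspace.
  suff : mass y @[y --> w] --> mass w by [].
  apply: (cvg_trans (near_eq_cvg near_w)).
  apply: fine_cvg; rewrite -massE upper_halfspace_halfspace//.
  apply: (@continuous_comp _ _ _ (fun w => (hdir w, hoff w))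
    (fun H => mu (halfspace H.1 H.2))).
    apply: (@cvg_pair _ _ _ (nbhs w) (nbhs (hdir w)) (nbhs (hoff w))).
      exact: hdir_continuous.
    exact: hoff_continuous.
  exact: mu_cont.
wlog ow : w w0 dw / 0 < off w.
  move=> h; have := off_neq0 w0 dw; case: ltgtP => // ow _; last exact: h.
  have hN : {for - w, continuous mass}.
    by apply: h; rewrite ?oppr_eq0// ?dirN ?dw ?oppr0// offN oppr_gt0.
  suff : mass y @[y --> w] --> mass w by [].
  have near_w : {near w, (fun y => 1 - mass (- y)) =1 mass}.
    by apply: filterS (near_neq0 w0) => y y0; rewrite massN// opprB addrC subrK.
  have -> : mass w = 1 - mass (- w) by rewrite massN// opprB addrC subrK.
  apply: (cvg_trans (near_eq_cvg near_w)).
  apply: (@cvgB _ _ _ (nbhs w)); first exact: cvg_cst.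
  by apply: (@continuous_comp _ _ _ (fun y : W => - y) mass) => //; exact: opp_continuous.
suff : mass y @[y --> w] --> mass w by [].
rewrite (mass_pole dw ow); apply/(@cvgrPdist_lt _ R _ (nbhs w)) => e e0.
have [k ke] : exists k : nat, (mu [set x : V | (k%:R <= `|x|)%R] < e%:E)%E.
  have := norm_far_cvg; move/fine_cvgP => [_ /cvgrPdist_lt/(_ _ e0)].
  move=> [k _ /(_ k (leqnn k))]; rewrite /= sub0r normrN => ke; exists k.
  have mA : measurable ([set x : V | k%:R <= `|x|] : set (g_sigma_algebraType (@open V))).
    exact: norm_ge_measurable.
  have muA := fin_num_measure mu _ mA.
  by rewrite -[ltLHS]fineK// lte_fin; exact: le_lt_trans (ler_norm _) ke.
(* Chosen so that [|dir y| < d] and [|x| < k] force [dir y . x <= d n k < off w / 2 < off y], which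
   keeps the half-space of [y] outside the ball of radius [k]. The factor [n] comes from bounding
   the scalar product by sup norms. *)
pose d := off w / 2 / (n%:R * k%:R + 1).
have nk : 0 < n%:R * k%:R + 1 :> R by rewrite ltr_pwDr// mulr_ge0.
have d0 : 0 < d by rewrite /d !divr_gt0.
have ow2 : 0 < off w / 2 by rewrite divr_gt0.
have near_off : \forall y \near w, `|off w - off y| < off w / 2.
  by have /(@cvgrPdist_lt _ R _ (nbhs w))/(_ _ ow2) := @off_continuous w.
have near_dir : \forall y \near w, `|dir w - dir y| < d.
  by have /(@cvgrPdist_lt _ V _ (nbhs w))/(_ _ d0) := @dir_continuous w.
apply: filterS2 near_off near_dir => y yo yd.
have yo' : off w / 2 < off y.
  by have := le_lt_trans (ler_norm _) yo; lra.
rewrite dw sub0r normrN in yd.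
rewrite sub0r normrN ger0_norm ?fine_ge0// -lte_fin -massE.
suff sub : upper_halfspace (dir y) (off y) `<=` [set x : V | k%:R <= `|x|].
  apply: le_lt_trans ke; apply: le_measure; rewrite ?inE//.
    exact: upper_halfspace_measurable.
  exact: norm_ge_measurable.
move=> x; rewrite /upper_halfspace/= => yx; rewrite leNgt; apply/negP => xk.
have h1 := le_trans (ler_norm _) (dot_norm (dir y) x).
have h2 : n%:R * `|dir y| * `|x| <= d * (n%:R * k%:R).
  by rewrite [leRHS]mulrA [d * _]mulrC ler_pM ?mulr_ge0// ?ler_wpM2l// ltW.
have h3 : d * (n%:R * k%:R + 1) = off w / 2 by rewrite /d divfK// gt_eqF.
have h4 : d * (n%:R * k%:R) + d = off w / 2 by rewrite -h3 mulrDr mulr1.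
have : off y < off y.
  apply: le_lt_trans (le_trans yx (le_trans h1 h2)) (lt_trans _ yo').
  by rewrite -h4 ltrDl.
by rewrite ltxx.
Qed.

End HomogeneousCoordinates.

(** * Hyperplanes and the line bundle *)

Section Bundle.
Variables (R : realType) (n : nat).
Local Notation V := 'rV[R]_n.
Implicit Types (u v : sphere R n) (t : R).

Lemma double_cover_eq u v :
  double_cover u = double_cover v -> val u = val v \/ val u = - val v.
Proof.
move=> uv; have /orP[/eqP->|/eqP->] : antipodal u v by apply/eqmodP.
  by left.
by right.
Qed.

Lemma double_cover_opp u : double_cover (sphere_opp u) = double_cover u.
Proof. by apply/eqmodP; rewrite /= /antipodal/= eqxx orbT. Qed.

Lemma double_cover_continuous : continuous (@double_cover R n).
Proof. exact: pi_continuous. Qed.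

Lemma bundle_point_subproof u t :
  (double_cover u, t *: val u) \in canonical_bundle R n.
Proof. by apply/mem_set; exists u, t. Qed.

Definition bundle_point u t : canonical_bundle R n :=
  @exist _ (fun z => z \in canonical_bundle R n) _ (bundle_point_subproof u t).

Lemma bundle_hyperplane_point u t :
  bundle_hyperplane (bundle_point u t) = hyperplane u t.
Proof.
apply/seteqP; split=> y /= yu.
  have := yu (val u); rewrite dotBr dotZr dot_unit mulr1 => h.
  by apply/eqP; rewrite -subr_eq0 h//; exists u, 1; rewrite scale1r.
move=> _ [v [a [/double_cover_eq vu ->]]].
rewrite dotZl; case: vu => ->; rewrite ?dotNl dotBr dotZr dot_unit mulr1 yu.
  by rewrite subrr mulr0.
by rewrite subrr oppr0 mulr0.
Qed.

(** The part [w] of [v] orthogonal to [u] is a direction of the common hyperplane, hence orthogonal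
    to [v] too and so zero; unit vectors on one line agree up to sign. *)
Lemma hyperplane_eq u t v s : hyperplane u t = hyperplane v s ->
  v = u /\ s = t \/ v = sphere_opp u /\ s = - t.
Proof.
move=> uv; pose d := dot (val v) (val u).
have vt : t * d = s.
  have : hyperplane u t (t *: val u) by rewrite /hyperplane/= dotZr dot_unit mulr1.
  by rewrite uv /hyperplane/= dotZr.
pose w := val v - d *: val u.
have uw : dot (val u) w = 0.
  by rewrite dotBr dotZr dot_unit mulr1 dotC subrr.
have vw : dot (val v) w = 0.
  have : hyperplane u t (t *: val u + w).
    by rewrite /hyperplane/= dotDr uw addr0 dotZr dot_unit mulr1.
  rewrite uv /hyperplane/= dotDr dotZr -/d vt => /eqP.
  by rewrite -subr_eq0 addrAC subrr add0r => /eqP.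
have w0 : w = 0.
  by apply: dot_eq0; rewrite {1}/w dotC dotBr dotZr ![dot w _]dotC uw vw mulr0 subrr.
have vE : val v = d *: val u by apply/eqP; rewrite -subr_eq0 -/w w0.
have : d ^+ 2 = 1 by rewrite -(dot_unit v) {1}vE dotZl vE dotZr dot_unit mulr1.
move/eqP; rewrite sqrf_eq1 => /orP[/eqP d1|/eqP d1]; [left|right].
  by split; [apply: val_inj; rewrite vE d1 scale1r | rewrite -vt d1 mulr1].
by split; [apply: val_inj; rewrite /= vE d1 scaleN1r | rewrite -vt d1 mulrN1].
Qed.

Variables (mu : 'I_n -> deviation_measure R n) (u0 : sphere R n).
Local Notation W := 'rV[R]_(1 + n).
Implicit Types w : W.

(** The bundle point of the hyperplane bounding the half-space of [w], taken in the ambient product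
    so that continuity is checked componentwise. *)
Definition bundle_coord w : projective_space R n * V :=
  (double_cover (hdir u0 w), hoff w *: val (hdir u0 w)).

Lemma bundle_coordN w : dir w != 0 -> bundle_coord (- w) = bundle_coord w.
Proof.
move=> w0; rewrite /bundle_coord hdirN// hoffN double_cover_opp/=.
by rewrite scaleNr scalerN opprK.
Qed.

Lemma bundle_coord_continuous w : dir w != 0 -> {for w, continuous bundle_coord}.
Proof.
move=> w0; apply: (@cvg_pair _ _ _ (nbhs w) (nbhs (double_cover (hdir u0 w)))
   (nbhs (hoff w *: val (hdir u0 w)))).
  apply: (@continuous_comp _ _ _ (hdir u0) (@double_cover R n)).
    exact: hdir_continuous.
  exact: double_cover_continuous.
apply: (@cvgZ _ _ _ (nbhs w)); first exact: hoff_continuous.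
apply: (@continuous_comp _ _ _ (hdir u0) (fun u : sphere R n => val u)).
  exact: hdir_continuous.
exact: initial_continuous.
Qed.

(** The lower bound on [mass] serves the half-space of [w], the upper bound the opposite one. *)
Lemma reliable_bundle_point w : dir w != 0 ->
  (forall i, deviation (mu i) <= mass (mu i) w <= 1 - deviation (mu i)) ->
  reliable_hyperplanes mu (bundle_point (hdir u0 w) (hoff w)).
Proof.
move=> w0 w_dev i u t; rewrite bundle_hyperplane_point.
have /andP[w1 w2] := w_dev i.
move/hyperplane_eq => [[-> ->]|[-> ->]].
  by rewrite -upper_halfspace_halfspace// massE lee_fin.
rewrite halfspace_opp; last exact: dev_measure_continuous.
by rewrite -upper_halfspace_halfspace// massE -EFinB lee_fin; lra.
Qed.

Variable p : reliable_hyperplanes mu -> sphere R n.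
Hypothesis p_cont : continuous p.
Hypothesis p_lift : forall z, (val (val z)).1 = double_cover (p z).

(* [p] transported to the ambient space of the bundle, [0] off its domain. *)
Definition lift_ext (y : projective_space R n * V) : V :=
  if pselect (exists z : reliable_hyperplanes mu, val (val z) = y) is left ex
  then val (p (projT1 (cid ex))) else 0.

Lemma lift_extE (z : reliable_hyperplanes mu) : lift_ext (val (val z)) = val (p z).
Proof.
rewrite /lift_ext; case: pselect => [ex|[]]; last by exists z.
by case: cid => z' /= /val_inj/val_inj ->.
Qed.

(** Continuity of [p] for the two nested subspace topologies, expressed by neighbourhoods in the
    ambient product. *)
Lemma near_lift_ext (z : reliable_hyperplanes mu) (B : set V) :
  nbhs (lift_ext (val (val z))) B ->
  exists2 C, nbhs (val (val z)) C &
    forall z' : reliable_hyperplanes mu,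
      C (val (val z')) -> B (lift_ext (val (val z'))).
Proof.
rewrite lift_extE => pzB.
have := p_cont (x := z) (@initial_continuous _ _ (fun u : sphere R n => val u) _ _ pzB).
move=> /nbhs_set_type[C1 [oC1 C1z C1B]].
have /nbhs_set_type[C2 [oC2 C2z C2C1]] := open_nbhs_nbhs (conj oC1 C1z).
exists C2; first exact: open_nbhs_nbhs.
by move=> z' /C2C1/C1B/=; rewrite lift_extE.
Qed.

(** Compares the normal of [w] with the one chosen by the lift [p]: [1] or [-1] on reliable
    hyperplanes, [0] elsewhere. It is odd because [w] and [- w] give the same hyperplane and
    opposite normals. *)
Definition lift_sign w : R :=
  if dir w == 0 then 0 else dot (val (hdir u0 w)) (lift_ext (bundle_coord w)).

Lemma lift_signN w : lift_sign (- w) = - lift_sign w.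
Proof.
rewrite /lift_sign dirN oppr_eq0; case: eqP => [_|/eqP w0]; first by rewrite oppr0.
by rewrite bundle_coordN// hdirN//= dotNl.
Qed.

Lemma lift_sign_reliable w (z : reliable_hyperplanes mu) : dir w != 0 ->
  val (val z) = bundle_coord w -> `|lift_sign w| = 1.
Proof.
move=> w0 zw; rewrite /lift_sign (negbTE w0) -zw lift_extE.
have /double_cover_eq[<-|] : double_cover (p z) = double_cover (hdir u0 w).
- by rewrite -p_lift zw.
- by rewrite dot_unit normr1.
- by move=> ->; rewrite dotNr dot_unit normrN normr1.
Qed.

Lemma lift_sign_le1 w : `|lift_sign w| <= 1.
Proof.
have [ex|nex] := pselect (dir w != 0 /\
    exists z : reliable_hyperplanes mu, val (val z) = bundle_coord w).
  by case: ex => w0 [z zw]; rewrite (lift_sign_reliable w0 zw).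
rewrite /lift_sign; case: eqP => [_|/eqP w0]; first by rewrite normr0.
rewrite /lift_ext; case: pselect => [ex|_]; first by case: nex.
by rewrite dotC dot0l normr0.
Qed.

(** Continuity of [lift_ext] is available only relative to the reliable hyperplanes, so these have
    to fill a neighbourhood of [w]. *)
Lemma lift_sign_continuous w : dir w != 0 ->
  (\forall y \near w,
    exists z : reliable_hyperplanes mu, val (val z) = bundle_coord y) ->
  {for w, continuous lift_sign}.
Proof.
move=> w0 near_z; have [z zw] := nbhs_singleton near_z.
have lc : lift_ext (bundle_coord y) @[y --> w] --> lift_ext (bundle_coord w).
  rewrite -zw => B /near_lift_ext[C zC CB]; rewrite zw in zC.
  have wC : \forall y \near w, C (bundle_coord y).
    exact: (bundle_coord_continuous w0 zC).
  apply: (@filterS2 _ (nbhs w) _ _ _ _ _ near_z wC) => y [z' z'y].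
  by rewrite /= -z'y; exact: CB.
have hc : val (hdir u0 y) @[y --> w] --> val (hdir u0 w).
  apply: (@continuous_comp _ _ _ (hdir u0) (fun u : sphere R n => val u)).
    exact: hdir_continuous.
  exact: initial_continuous.
suff : lift_sign y @[y --> w] --> lift_sign w by [].
have near_w : {near w,
    (fun y => dot (val (hdir u0 y)) (lift_ext (bundle_coord y))) =1 lift_sign}.
  by apply: filterS (near_dir_neq0 w0) => y y0; rewrite /lift_sign (negbTE y0).
rewrite {2}/lift_sign (negbTE w0).
apply: (cvg_trans (near_eq_cvg near_w)).
apply: (@continuous_comp _ _ _
  (fun y => (val (hdir u0 y), lift_ext (bundle_coord y)))
  (fun q : V * V => dot q.1 q.2)).
  exact: (@cvg_pair _ _ _ (nbhs w) (nbhs (val (hdir u0 w)))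
    (nbhs (lift_ext (bundle_coord w)))).
exact: dot_pair_continuous.
Qed.

End Bundle.

(** * Half-spaces with prescribed measures for a flat family *)

Theorem theorem6p8 (R : realType) (n : nat) (n_gt0 : (0 < n)%N)
    (mu : 'I_n -> deviation_measure R n) (flat_mu : flat mu)
    (alpha : 'I_n -> R)
    (alphaE : forall i, alpha i = deviation (mu i) \/
                        alpha i = 1 - deviation (mu i)) :
  exists H : set 'rV[R]_n,
    is_halfspace H /\ forall i, mu i H = (alpha i)%:E.
Proof.
have [p [p_cont p_lift]] := flat_mu.
pose u0 := unit_vector R n_gt0.
have mu_cont i := @dev_measure_continuous _ _ (mu i).
have massN' i w : w != 0 -> mass (mu i) (- w) = 1 - mass (mu i) w.
  exact: massN u0 (mu_cont i) w.
pose b i := alpha i - 2^-1.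
have bE i : `|b i| = 2^-1 - deviation (mu i).
  have /andP[e0 e2] := deviation_bounds (mu i); rewrite /b.
  case: (alphaE i) => ->; first by rewrite ler0_norm; lra.
  by rewrite ger0_norm; lra.
have b0 i : b i != 0.
  have /andP[_ e2] := deviation_bounds (mu i).
  by rewrite -normr_gt0 bE subr_gt0.
(* With this scaling [phi w = (1, ..., 1)] says that [mass (mu i) w = alpha i] for all [i], and
   [|phi w| <= 1] that each mass lies between [deviation (mu i)] and [1 - deviation (mu i)]. *)
pose phi (w : 'rV[R]_(1 + n)) : 'rV[R]_n := \row_i ((mass (mu i) w - 2^-1) / b i).
have phi_coord w i : `|phi w ord0 i| = `|mass (mu i) w - 2^-1| / `|b i|.
  by rewrite mxE normrM normfV.
have near_reliable (w : 'rV[R]_(1 + n)) : w != 0 -> `|phi w| < 1 ->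
    dir w != 0 /\ exists z : reliable_hyperplanes mu, val (val z) = bundle_coord u0 w.
  move=> w0 phi1.
  have mi i : `|mass (mu i) w - 2^-1| < `|b i|.
    rewrite -[ltRHS]mul1r -ltr_pdivrMr ?normr_gt0// -phi_coord.
    exact: le_lt_trans (coord_norm_le _ _) phi1.
  (* At a pole all masses are [0] or all are [1], at distance [1/2] from the centre, while
     [|b i| <= 1/2]. *)
  have dw : dir w != 0.
    apply/eqP => dw; pose i := Ordinal n_gt0.
    have := mi i; rewrite bE; have /andP[e0 e2] := deviation_bounds (mu i).
    have [ow|ow] : 0 < off w \/ 0 < off (- w).
      rewrite offN oppr_gt0.
      by have := off_neq0 w0 dw; case: (ltgtP (off w) 0) => // _ _; [right|left].
    - by rewrite mass_pole// ltr_norml => /andP[h1 h2]; lra.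
    - have dNw : dir (- w) = 0 by rewrite dirN dw oppr0.
      have := massN' i w w0; rewrite mass_pole// => m1.
      by rewrite ltr_norml => /andP[h1 h2]; lra.
  split=> //.
  have rel : reliable_hyperplanes mu (bundle_point (hdir u0 w) (hoff w)).
    apply: reliable_bundle_point => // i.
    by have := mi i; rewrite bE ltr_norml => /andP[h1 h2]; lra.
  by exists (@exist _ (fun z => z \in reliable_hyperplanes mu) _ (mem_set rel)).
have phi_cont w : w != 0 -> {for w, continuous phi}.
  move=> w0; apply: row_continuous => i.
  rewrite (_ : (fun y => phi y ord0 i) =
      (fun y => (mass (mu i) y - 2^-1) / b i)); last first.
    by apply/funext => y; rewrite mxE.
  apply: (@cvgMl _ _ (nbhs w)); apply: (@cvgB _ _ _ (nbhs w)); last exact: cvg_cst.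
  exact: (mass_continuous u0 (mu_cont i) w0).
have near_phi (w : 'rV[R]_(1 + n)) : w != 0 -> `|phi w| < 1 ->
    \forall y \near w, y != 0 /\ `|phi y| < 1.
  move=> w0 phi1.
  have r0 : 0 < 1 - `|phi w| by rewrite subr_gt0.
  have /(@cvgrPdist_lt _ 'rV[R]_n _ (nbhs w))/(_ _ r0) := phi_cont w w0.
  apply: filterS2 (near_neq0 w0) => y y0 wy; split=> //.
  by have := ler_distD (phi w) (phi y) 0; rewrite !subr0 (distrC (phi y)); lra.
have [w Kw phiw] : exists2 w, @crosspolytope R n w & phi w = const_mx 1.
  apply: (@odd_image R n phi (lift_sign u0 p)) => //.
  - apply/eqP; rewrite eq_le; apply/andP; split.
      by apply: norm_le_coord => // i; rewrite mxE normr1.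
    by apply: le_trans (coord_norm_le _ (Ordinal n_gt0)); rewrite mxE normr1.
  - move=> w w0; apply/rowP => i; rewrite !mxE massN'// -mulNr; congr (_ / _).
    by lra.
  - exact: lift_signN.
  - exact: lift_sign_le1.
  - move=> w w0 phi1; have [dw [z zw]] := near_reliable w w0 phi1.
    exact: (lift_sign_reliable p_lift dw zw).
  - move=> w w0 phi1; have [dw _] := near_reliable w w0 phi1.
    apply: lift_sign_continuous => //.
    by apply: filterS (near_phi w w0 phi1) => y [y0 /(near_reliable y y0)[]].
have massw i : mass (mu i) w = alpha i.
  have := congr1 (fun v : 'rV[R]_n => v ord0 i) phiw; rewrite !mxE => h.
  apply: (addIr (- 2^-1)); transitivity (1 * b i); last by rewrite mul1r.
  by rewrite -[X in X * _]h divfK ?b0.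
have w0 := crosspolytope_neq0 Kw.
have [dw|dw] := eqVneq (dir w) 0; last first.
  exists (upper_halfspace (dir w) (off w)); split=> [|i]; last by rewrite massE massw.
  by exists (hdir u0 w), (hoff w); exact: upper_halfspace_halfspace.
have [M MP] := choice (fun i =>
  compact_support_halfspace u0 (@dev_measure_compact _ _ (mu i))).
(* All [alpha i] are [0] or all are [1]: move a hyperplane off the supports. *)
pose t := \sum_i `|M i|.
have tnull i : mu i (halfspace u0 t) = 0%E.
  apply: MP; apply: le_trans (ler_norm _) _.
  by rewrite /t (bigD1 i)//= lerDl sumr_ge0.
have [ow|ow] : 0 < off w \/ 0 < off (- w).
  rewrite offN oppr_gt0.
  by have := off_neq0 w0 dw; case: (ltgtP (off w) 0) => // _ _; [right|left].
- exists (halfspace u0 t); split=> [|i]; first by exists u0, t.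
  by rewrite tnull -massw mass_pole.
- exists (halfspace (sphere_opp u0) (- t)); split=> [|i].
    by exists (sphere_opp u0), (- t).
  have := massN' i w w0; rewrite mass_pole ?dirN ?dw ?oppr0// massw => /eqP.
  rewrite eq_sym subr_eq0 => /eqP <-.
  by rewrite halfspace_opp// tnull sube0.
Qed.
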